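(* Let $n\ge2$ and for $q=(q_1,\dots,q_n)\in\mathbb{R}^n$ put $$\|q\|_{\mathbb R}=\frac{1}{\sigma(\mathbb{S}^{n-1})}\int_{\mathbb{S}^{n-1}}\sqrt{\sum_{i=1}^n q_i^2x_i^2}\;d\sigma(x),\qquad \|q\|=\Big(\sum_{i=1}^n q_i^2\Big)^{1/2}.$$ Over nonzero $q$, the minimal value of $\|q\|_{\mathbb R}/\|q\|$ equals $$\frac{1}{\sigma(\mathbb{S}^{n-1})}\int_{\mathbb{S}^{n-1}}|x_1|\,d\sigma=\frac{\Gamma\left(\frac n2\right)}{\sqrt\pi\,\Gamma\left(\frac{n+1}{2}\right)},$$ and the maximal value equals $1/\sqrt n$. In other words, for every nonzero $q$, $$\frac{\Gamma\left(\frac n2\right)}{\sqrt\pi\,\Gamma\left(\frac{n+1}{2}\right)}\le\frac{\|q\|_{\mathbb R}}{\|q\|}\le\frac1{\sqrt n},$$ and both bounds are attained.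
   Context: $\mathbb{S}^{n-1}$ is the unit sphere in $\mathbb{R}^n$ and $\sigma$ its standard surface area measure. (When all $q_i>0$, $n\|q\|_{\mathbb R}$ is the ratio of surface area to volume of the ellipsoid $\{\sum q_i^2x_i^2\le1\}$.) *)

(* Defs.v *)
From HB Require Import structures.
From mathcomp Require Import all_boot all_order all_algebra.
From mathcomp Require Import all_classical all_reals all_analysis measurable_realfun.

Set Implicit Arguments.
Unset Strict Implicit.
Unset Printing Implicit Defensive.
Import Order.TTheory GRing.Theory Num.Theory.
Import numFieldNormedType.Exports.

Local Open Scope classical_set_scope.
Local Open Scope ring_scope.

(* R^n is [n.-tuple R], which carries the product sigma-algebra. *)

Definition tuple_cons (R : realType) (n : nat)
    (p : measurableTypeR R * n.-tuple R) : n.+1.-tuple R :=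
  [the n.+1.-tuple R of p.1 :: p.2].

Lemma measurable_tuple_cons (R : realType) (n : nat) :
  measurable_fun [set: measurableTypeR R * n.-tuple R] (@tuple_cons R n).
Proof. exact: (@measurable_cons _ _ _ R fst n snd). Qed.

Section cons_measure.
Local Open Scope ereal_scope.
Context (R : realType) (n : nat).
Variable mu : {sigma_finite_measure set (n.-tuple R) -> \bar R}.

Definition cons_measure : set (n.+1.-tuple R) -> \bar R :=
  pushforward (@lebesgue_measure R \x mu) (@tuple_cons R n).

Let cons_measure0 : cons_measure set0 = 0.
Proof. by rewrite /cons_measure /pushforward preimage_set0 measure0. Qed.

Let cons_measure_ge0 A : 0 <= cons_measure A.
Proof. by rewrite /cons_measure /pushforward measure_ge0. Qed.

Let cons_measure_sigma_additive : semi_sigma_additive cons_measure.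
Proof.
apply: measure_semi_sigma_additive; exact: measurable_tuple_cons.
Qed.

HB.instance Definition _ := isMeasure.Build _ _ _ cons_measure
  cons_measure0 cons_measure_ge0 cons_measure_sigma_additive.

Let cons_measure_sigma_finite : sigma_finite setT cons_measure.
Proof.
have /sigma_finiteP[G [TG ndG Goo]] := sigma_finiteT (@lebesgue_measure R).
have /sigma_finiteP[H [TH ndH Hoo]] := sigma_finiteT mu.
pose F k : set (measurableTypeR R * n.-tuple R) := G k `*` H k.
have TF : setT = \bigcup_k F k.
  rewrite -setXTT TG TH; apply/seteqP; split=> -[x y] /=.
    move=> [[i _ Gx] [j _ Hy]]; exists (maxn i j) => //; split.
    - by move: x Gx; exact/subsetPset/ndG/leq_maxl.
    - by move: y Hy; exact/subsetPset/ndH/leq_maxr.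
  by move=> [i _ []/= ? ?]; split; exists i.
have Foo k : measurable (F k) /\ (@lebesgue_measure R \x mu) (F k) < +oo.
  have [? ?] := Goo k; have [? ?] := Hoo k; split; first exact: measurableX.
  by rewrite product_measure1E// lte_mul_pinfty// ge0_fin_numE.
pose uncons (x : n.+1.-tuple R) : measurableTypeR R * n.-tuple R :=
  (thead x, [tuple of behead x]).
have muncons : measurable_fun [set: n.+1.-tuple R] uncons.
  apply: measurable_fun_pair => /=; first exact: measurable_tnth.
  exact: measurable_behead.
have unconsK p : uncons (tuple_cons p) = p.
  by case: p => a t; rewrite /uncons /thead tnth0; congr (_, _); exact: val_inj.
exists (fun k => uncons @^-1` F k) => [|k].
  by rewrite -preimage_bigcup -TF preimage_setT.
have [mFk Fkoo] := Foo k; split.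
  by rewrite -[X in measurable X]setTI; exact: muncons.
rewrite /cons_measure /pushforward -comp_preimage.
rewrite (_ : _ @^-1` F k = F k)//.
by apply/seteqP; split => p /=; rewrite unconsK.
Qed.

HB.instance Definition _ := Measure_isSigmaFinite.Build _ _ _ cons_measure
  cons_measure_sigma_finite.

End cons_measure.

Fixpoint lebesgue_tuple (R : realType) (n : nat) :
    {sigma_finite_measure set (n.-tuple R) -> \bar R} :=
  match n with
  | 0 => \d_[tuple]
  | m.+1 => cons_measure (lebesgue_tuple R m)
  end.

Section sphere.
Context (R : realType) (n : nat).

Definition enorm (x : n.-tuple R) : R := Num.sqrt (\sum_(i < n) tnth x i ^+ 2).

Definition scale_tuple (r : R) (x : n.-tuple R) : n.-tuple R :=
  [tuple r * tnth x i | i < n].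

Definition sphere : set (n.-tuple R) := [set x | enorm x = 1].

Definition cone (A : set (n.-tuple R)) : set (n.-tuple R) :=
  [set x | exists r y, [/\ 0 < r <= 1, sphere y, A y & x = scale_tuple r y]].

(* sigma(A) = n * Leb{r y : 0 < r <= 1, y in A}, which is the value forced by
   integration in polar coordinates.  The measure lives on the Borel sets of
   R^n and is concentrated on the unit sphere. *)
Definition surface_measure (A : set (n.-tuple R)) : \bar R :=
  (n%:R%:E * lebesgue_tuple R n (cone A))%E.

Lemma enorm_scale r x : 0 <= r -> enorm (scale_tuple r x) = r * enorm x.
Proof.
move=> r0; rewrite /enorm.
under eq_bigr do rewrite tnth_mktuple exprMn.
by rewrite -mulr_sumr sqrtrM ?sqr_ge0// sqrtr_sqr ger0_norm.
Qed.

Lemma coneE A : cone A =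
  [set x | 0 < enorm x <= 1] `&`
  (fun x => scale_tuple (enorm x)^-1 x) @^-1` A.
Proof.
have scaleK r s x : scale_tuple r (scale_tuple s x) = scale_tuple (r * s) x.
  by apply: eq_from_tnth => i; rewrite !tnth_mktuple mulrA.
have scale1 x : scale_tuple 1 x = x.
  by apply: eq_from_tnth => i; rewrite !tnth_mktuple mul1r.
apply/seteqP; split => [x [r [y [/andP[r0 r1] y1 Ay ->]]]|x [/andP[x0 x1] Ax]].
  have ry : enorm (scale_tuple r y) = r by rewrite enorm_scale ?ltW// y1 mulr1.
  by split=> /=; rewrite ry ?r0// scaleK mulVf ?gt_eqF// scale1.
exists (enorm x), (scale_tuple (enorm x)^-1 x); split => //; first by rewrite x0.
  by rewrite /sphere /= enorm_scale ?invr_ge0 ?ltW// mulVf ?gt_eqF.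
by rewrite scaleK divff ?gt_eqF// scale1.
Qed.

Lemma measurable_enorm : measurable_fun [set: n.-tuple R] enorm.
Proof.
rewrite (_ : enorm = fun x => (\sum_(i < n) tnth x i ^+ 2) `^ 2^-1).
  apply: (@measurableT_comp _ _ _ _ _ _ (@powR R ^~ 2^-1)) => //.
  apply: measurable_sum => i; apply: measurable_funX; exact: measurable_tnth.
by apply/funext => x; rewrite powR12_sqrt// sumr_ge0// => i _; exact: sqr_ge0.
Qed.

Lemma measurable_normalize : measurable_fun [set: n.-tuple R]
  (fun x => scale_tuple (enorm x)^-1 x).
Proof.
apply/measurable_fun_tnthP => i.
rewrite (_ : _ \o _ = fun x => enorm x `^ (-1) * tnth x i).
  apply: measurable_funM; last exact: measurable_tnth.
  apply: (@measurableT_comp _ _ _ _ _ _ (@powR R ^~ (-1))) => //.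
  exact: measurable_enorm.
by apply/funext => x /=; rewrite tnth_mktuple powR_inv1// sqrtr_ge0.
Qed.

Lemma measurable_cone A : measurable A -> measurable (cone A).
Proof.
move=> mA; rewrite coneE; apply: measurableI.
  rewrite (_ : [set _ | _] = [set: n.-tuple R] `&` enorm @^-1` `]0, 1]%classic).
    by apply: measurable_enorm.
  by rewrite setTI; apply/seteqP; split => x /=; rewrite in_itv.
by rewrite -[X in measurable X]setTI; exact: measurable_normalize.
Qed.

Local Open Scope ereal_scope.

Let surface_measure0 : surface_measure set0 = 0.
Proof.
by rewrite /surface_measure coneE preimage_set0 setI0 measure0 mule0.
Qed.

Let surface_measure_ge0 A : 0 <= surface_measure A.
Proof. by rewrite /surface_measure mule_ge0// lee_fin. Qed.

Let surface_measure_sigma_additive : semi_sigma_additive surface_measure.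
Proof.
have nE A : surface_measure A = mscale (n%:R%:nng)%R (lebesgue_tuple R n) (cone A).
  by [].
move=> F mF tF mUF.
rewrite (_ : (fun _ => _) = (fun m => \sum_(0 <= i < m)
  mscale (n%:R%:nng)%R (lebesgue_tuple R n) (cone (F i)))); last first.
  by apply/funext => m; apply: eq_bigr.
rewrite nE (_ : cone (\bigcup_m F m) = \bigcup_m cone (F m)); last first.
  rewrite coneE preimage_bigcup setI_bigcupr.
  by apply: eq_bigcupr => m _; rewrite coneE.
apply: measure_semi_sigma_additive.
- by move=> m; exact: measurable_cone.
- apply/trivIsetP => i j _ _ ij; rewrite !coneE -subset0 => x [[_ Fi] [_ Fj]].
  move/trivIsetP : tF => /(_ _ _ I I ij); rewrite -subset0.
  by move=> /(_ (scale_tuple (enorm x)^-1 x)); apply; split.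
- by apply: bigcup_measurable => m _; exact: measurable_cone.
Qed.

HB.instance Definition _ := isMeasure.Build _ _ _ surface_measure
  surface_measure0 surface_measure_ge0 surface_measure_sigma_additive.

End sphere.

Arguments sphere R n : clear implicits.
Arguments surface_measure R n : clear implicits.

Definition sphere_mean (R : realType) (n : nat) (f : n.-tuple R -> R) : R :=
  (\int[surface_measure R n]_(x in sphere R n) f x) /
  fine (surface_measure R n (sphere R n)).

(* The norm written ||q||_R; [enorm] is the Euclidean norm ||q||. *)
Definition mean_norm (R : realType) (n : nat) (q : n.-tuple R) : R :=
  sphere_mean (fun x =>
    Num.sqrt (\sum_(i < n) tnth q i ^+ 2 * tnth x i ^+ 2)).

(* Euler's integral, used at s > 0 only, where it converges. *)
Definition Gamma (R : realType) (s : R) : R :=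
  \int[@lebesgue_measure R]_(t in `]0, +oo[) (t `^ (s - 1) * expR (- t)).

(* Main.v *)
Require Import Defs.
From mathcomp Require Import all_boot all_order all_algebra.
From mathcomp Require Import all_classical all_reals all_analysis measurable_realfun.
From mathcomp Require Import ring lra.

Set Implicit Arguments.
Unset Strict Implicit.
Unset Printing Implicit Defensive.
Import Order.TTheory GRing.Theory Num.Theory.
Import numFieldNormedType.Exports.
Local Open Scope classical_set_scope.
Local Open Scope ring_scope.

(** Both bounds are Jensen's inequality for the square root once the means of
    [|x_i|] and [x_i^2] over the sphere are known.  With weights
    [p_i = q_i^2 / |q|^2], concavity gives
    [sqrt (\sum_i p_i x_i^2) >= \sum_i p_i |x_i|] pointwise, hence the lower bound
    after averaging; and averaging first gives the upper bound, since the mean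
    of [x_i^2] is [1 / n].

    The means come from Gaussian integrals.  Tonelli's theorem and the scaling
    behaviour of Lebesgue measure yield, for [h] homogeneous of degree 0,
    [c * \int h(x) g(|x|^2) dx = D(h) * \int_0^oo s^(n/2 - 1) g(s) ds],
    where [c] does not depend on [h], [g], nor [D(h)] on [g].  Taking for [g] the
    indicator of [(0, 1]] relates [D(h)] to the mean of [h] over the sphere, and
    taking [g(s) = e^-s], [sqrt s e^-s], [s e^-s] evaluates [D(h)] for [h = 1],
    [|x_i| / |x|], [x_i^2 / |x|^2], the left-hand side being a product of
    one-dimensional integrals. *)

(** * Scaling and product formulas for Lebesgue measure on tuples *)

(** The right-hand side is a measure in [A]. On []b, c]] it equals a (c/a - b/a) = c - b, so
    uniqueness of Lebesgue measure identifies the two. *)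
Lemma lebesgue_measure_preimage_scale (R : realType) (a : R) (A : set R) :
  0 < a -> measurable A ->
  (lebesgue_measure A = a%:E * lebesgue_measure ( *%R a @^-1` A))%E.
Proof.
move=> a0 mA.
have ma : measurable_fun [set: measurableTypeR R] ( *%R a : measurableTypeR R -> measurableTypeR R).
  by apply: (@measurable_funM _ (measurableTypeR R) R setT (cst a) id).
pose phi : measurableTypeR R -> measurableTypeR R := *%R a.
pose m :=
  mscale (NngNum (ltW a0)) (pushforward (@lebesgue_measure R) phi)
  : {measure set (measurableTypeR R) -> \bar R}.
rewrite (@lebesgue_measure_unique R (m ma))//.
move=> X [[b c] _ <-] /=; rewrite /m/= /mscale/= /pushforward.
have -> : phi @^-1` `]b, c] = `]b / a, c / a]%classic.
  apply/seteqP; split => x /=; rewrite !in_itv /=;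
   by rewrite ler_pdivlMr// ltr_pdivrMr// ![x * a]mulrC.
rewrite !lebesgue_measure_itv/= !lte_fin ltr_pM2r ?invr_gt0//.
case: ifP => _; last by rewrite mule0.
by rewrite -!EFinD -EFinM mulrBr !(mulrC a) !divfK ?gt_eqF.
Qed.

Lemma ge0_integral_scale (R : realType) (a : R) (f : R -> \bar R) : 0 < a ->
  measurable_fun [set: R] f -> (forall x, 0 <= f x)%E ->
  (\int[lebesgue_measure]_x f x = a%:E * \int[lebesgue_measure]_x f (a * x)%R)%E.
Proof.
move=> a0 mf f0.
have ma : measurable_fun [set: measurableTypeR R] ( *%R a : measurableTypeR R -> measurableTypeR R).
  by apply: (@measurable_funM _ (measurableTypeR R) R setT (cst a) id).
pose phi : measurableTypeR R -> measurableTypeR R := *%R a.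
pose m :=
  mscale (NngNum (ltW a0)) (pushforward (@lebesgue_measure R) phi)
  : {measure set (measurableTypeR R) -> \bar R}.
rewrite (eq_measure_integral (m ma)); last first.
  by move=> A mA _; exact: (lebesgue_measure_preimage_scale a0 mA).
by rewrite /m ge0_integral_mscale// ge0_integral_pushforward// preimage_setT.
Qed.

Lemma lebesgue_tupleS_tonelli (R : realType) (n : nat)
    (f : n.+1.-tuple R -> \bar R) :
  measurable_fun setT f -> (forall x, 0 <= f x)%E ->
  (\int[lebesgue_tuple R n.+1]_x f x =
   \int[lebesgue_measure]_t \int[lebesgue_tuple R n]_y f (tuple_cons (t, y)))%E.
Proof.
move=> mf f0.
rewrite [LHS](@ge0_integral_pushforward _ _ _ _ R _ (@measurable_tuple_cons R n)
  (@lebesgue_measure R \x lebesgue_tuple R n)%E setT f)// preimage_setT.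
rewrite (fubini_tonelli1 (f \o @tuple_cons R n))//.
  by apply: measurableT_comp => //; exact: measurable_tuple_cons.
by move=> z; exact: f0.
Qed.

Lemma measurable_scale_tuple (R : realType) (n : nat) (a : R) :
  measurable_fun setT (@scale_tuple R n a).
Proof.
apply/measurable_fun_tnthP => i.
rewrite (_ : _ \o _ = fun x : n.-tuple R => a * tnth x i).
  by apply: measurable_funM => //; exact: measurable_tnth.
by apply/funext => x /=; rewrite tnth_mktuple.
Qed.

Lemma scale_tuple_cons (R : realType) (n : nat) (a t : R) (y : n.-tuple R) :
  scale_tuple a (tuple_cons (t, y)) = tuple_cons (a * t, scale_tuple a y).
Proof.
apply: eq_from_tnth => i; rewrite tnth_mktuple.
case: (unliftP ord0 i) => [j ->|->]; last by rewrite !tnth0.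
by rewrite !tnthS tnth_mktuple.
Qed.

(** Induction on the dimension: Tonelli splits off the first coordinate, whose scaling contributes
    one factor [a], while the induction hypothesis contributes [a ^+ n]. *)
Lemma ge0_integral_scale_tuple (R : realType) (n : nat) (a : R)
    (f : n.-tuple R -> \bar R) : 0 < a ->
  measurable_fun setT f -> (forall x, 0 <= f x)%E ->
  (\int[lebesgue_tuple R n]_x f x =
   (a ^+ n)%:E * \int[lebesgue_tuple R n]_x f (scale_tuple a x))%E.
Proof.
move=> a0; elim: n f => [|n IH] f mf f0.
  by rewrite expr0 mul1e; apply: eq_integral => x _; rewrite [x]tuple0 [scale_tuple _ _]tuple0.
have mF : measurable_fun setT (f \o @tuple_cons R n).
  by apply: measurableT_comp => //; exact: measurable_tuple_cons.
have mfc t : measurable_fun setT (fun y => f (tuple_cons (t, y))).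
  by apply: (measurableT_comp mF); exact: pair1_measurable.
have mfs : measurable_fun setT (f \o scale_tuple a).
  by apply: measurableT_comp => //; exact: measurable_scale_tuple.
rewrite !lebesgue_tupleS_tonelli//.
rewrite (ge0_integral_scale a0)//; first last.
- by move=> x; apply: integral_ge0.
- apply: (measurable_fun_fubini_tonelli_F (f \o @tuple_cons R n)) => // z; exact: f0.
rewrite exprS EFinM -muleA; congr (_ * _)%E.
transitivity (\int[lebesgue_measure]_t ((a ^+ n)%:E *
    \int[lebesgue_tuple R n]_y (f \o scale_tuple a) (tuple_cons (t, y))))%E.
  apply: eq_integral => t _; rewrite IH//; congr (_ * _)%E.
  by apply: eq_integral => y _; rewrite /= scale_tuple_cons.
rewrite ge0_integralZl//.
- apply: (measurable_fun_fubini_tonelli_F ((f \o scale_tuple a) \o @tuple_cons R n)) => //.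
    by apply: measurableT_comp => //; exact: measurable_tuple_cons.
  by move=> z; exact: f0.
- by move=> x _; apply: integral_ge0 => z _; exact: f0.
- by rewrite lee_fin exprn_ge0 ?ltW.
Qed.

Lemma ge0_integral_tuple_prod (R : realType) (n : nat) (f : 'I_n -> R -> R)
    (c : 'I_n -> R) :
  (forall i, measurable_fun setT (f i)) -> (forall i x, 0 <= f i x) ->
  (forall i, \int[lebesgue_measure]_x (f i x)%:E = (c i)%:E)%E ->
  (\int[lebesgue_tuple R n]_x (\prod_i f i (tnth x i))%:E = (\prod_i c i)%:E)%E.
Proof.
elim: n f c => [|n IH] f c mf f0 fc.
  under eq_integral do rewrite big_ord0.
  by rewrite big_ord0 integral_cst//= mul1e diracT.
have mprod m (g : 'I_m -> R -> R) : (forall i, measurable_fun setT (g i)) ->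
    measurable_fun setT (fun x : m.-tuple R => (\prod_i g i (tnth x i))%:E).
  move=> mg; apply/measurable_EFinP; apply: measurable_prod => i _.
  by apply: (measurableT_comp (mg i)); exact: measurable_tnth.
rewrite lebesgue_tupleS_tonelli//; first last.
- by move=> x; rewrite lee_fin prodr_ge0.
- exact: mprod.
transitivity (\int[lebesgue_measure]_t ((f ord0 t)%:E *
    (\prod_(i < n) c (lift ord0 i))%:E))%E.
  apply: eq_integral => t _.
  under eq_integral do rewrite big_ord_recl tnth0 EFinM.
  rewrite (eq_integral (fun y : n.-tuple R => (f ord0 t)%:E *
      (\prod_(i < n) f (lift ord0 i) (tnth y i))%:E)%E); last first.
    move=> y _; congr (_ * _%:E)%E; apply: eq_bigr => i _.
    by rewrite tnthS.
  rewrite ge0_integralZl//; first by congr (_ * _)%E;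
    apply: (IH (fun i => f (lift ord0 i)) (fun i => c (lift ord0 i))).
  - by apply: (@mprod n (fun i => f (lift ord0 i))) => i; exact: mf.
  - by move=> x _; rewrite lee_fin prodr_ge0.
  - by rewrite lee_fin.
rewrite ge0_integralZr//.
- by rewrite fc big_ord_recl EFinM.
- by apply/measurable_EFinP; exact: mf.
- by move=> x _; rewrite lee_fin.
- rewrite lee_fin prodr_ge0// => i _; rewrite -lee_fin -fc.
  by apply: integral_ge0 => x _; rewrite lee_fin.
Qed.

(** * Polar coordinates: separating radius from direction by Tonelli *)

(* Any nonnegative kernel with a finite positive integral, supported away from
   [0], would do: it only serves to decouple radius and direction. *)
Definition radial_kernel (R : realType) (v : R) : R := \1_`[1, 2] v * v `^ (-1).

Lemma radial_kernel_ge0 (R : realType) (v : R) : 0 <= radial_kernel v.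
Proof. by rewrite mulr_ge0 ?powR_ge0// indicE. Qed.

Lemma radial_kernel_le0 (R : realType) (v : R) : v <= 0 -> radial_kernel v = 0.
Proof.
move=> v0; rewrite /radial_kernel indicE memNset ?mul0r//= in_itv/=.
by rewrite leNgt (le_lt_trans v0 ltr01).
Qed.

Lemma measurable_radial_kernel (R : realType) :
  measurable_fun setT (@radial_kernel R).
Proof.
by apply: measurable_funM; [exact: measurable_indic|exact: measurable_powR].
Qed.

(** On [[1, 2]] the kernel is 1/v, hence lies between 1/2 and 1, and elsewhere it is 0. Its integral
    therefore lies between 1/2 and 1. *)
Lemma integral_radial_kernel (R : realType) : exists2 c : R, 0 < c &
  (\int[lebesgue_measure]_v (radial_kernel v)%:E = c%:E)%E.
Proof.
have ind1 : (\int[lebesgue_measure]_v (\1_`[1, 2] v : R)%:E = 1)%E.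
  rewrite integral_indic// setIT [LHS]lebesgue_measure_itv/= lte_fin ltr1n.
  by rewrite -EFinD; congr EFin; lra.
have mi : measurable_fun setT (fun v : R => (\1_`[1, 2] v : R)%:E).
  exact/measurable_EFinP/measurable_indic.
have mk : measurable_fun setT (fun v : R => (radial_kernel v)%:E).
  by apply/measurable_EFinP; exact: measurable_radial_kernel.
have kP (v : R) : 2^-1 * \1_`[1, 2] v <= radial_kernel v <= \1_`[1, 2] v.
  rewrite /radial_kernel indicE mem_setE; case: (boolP (v \in _)) => //= [|_].
    rewrite in_itv/= => /andP[v1 v2]; rewrite mulr1 mul1r powR_inv1; last lra.
    by rewrite lef_pV2 ?posrE ?v2 ?invf_le1//; lra.
  by rewrite mulr0 mul0r lexx.
set I := (X in exists2 c, _ & X = c%:E).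
have Ile : (I <= 1)%E.
  rewrite -ind1; apply: ge0_le_integral => // v _; rewrite lee_fin.
  - exact: radial_kernel_ge0.
  - by have /andP[] := kP v.
have Ige : ((2^-1)%:E <= I)%E.
  have <- : (\int[lebesgue_measure]_v ((2^-1)%:E * (\1_`[1, 2] v : R)%:E) =
      (2^-1)%:E)%E.
    by rewrite ge0_integralZl ?ind1 ?mule1//.
  apply: ge0_le_integral => //.
  - by apply: measurable_funeM.
  - by move=> v _; rewrite -EFinM lee_fin; have /andP[] := kP v.
have If : (I \is a fin_num).
  rewrite ge0_fin_numE; first by rewrite (le_lt_trans Ile)// ltry.
  by rewrite (le_trans _ Ige)// lee_fin.
exists (fine I); last by rewrite fineK.
by rewrite -lte_fin fineK// (lt_le_trans _ Ige)// lte_fin.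
Qed.

Section polar.
Context (R : realType) (n : nat).
Variables (h : n.-tuple R -> R) (g : R -> R).
Hypotheses (mh : measurable_fun setT h) (h0 : forall x, 0 <= h x).
Hypothesis hZ : forall a x, 0 < a -> h (scale_tuple a x) = h x.
Hypotheses (mg : measurable_fun setT g) (g0 : forall s, 0 <= g s).
Hypothesis gneg : forall s, s <= 0 -> g s = 0.

(** This is D(h). The kernel confines y to the annulus 1/2 <= |y|^2 <= 1, so for [h] homogeneous of
    degree 0 the value is, up to a constant depending only on [n], the integral of [h] over all
    directions. The powers of |y|^2 are those left by the substitutions in [intFG] and [intG1]. *)
Definition directional_mass : \bar R :=
  (\int[lebesgue_tuple R n]_y (h y * radial_kernel ((enorm y ^+ 2) `^ (-1)) *
    (enorm y ^+ 2) `^ (-1) * (enorm y ^+ 2) `^ (- (n%:R / 2)))%:E)%E.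

Let p : R := n%:R / 2 - 1.
Let u (x : n.-tuple R) := enorm x ^+ 2.

Let u_ge0 x : 0 <= u x. Proof. exact: sqr_ge0. Qed.

Let mu : measurable_fun setT u.
Proof. by apply: measurable_funX; exact: measurable_enorm. Qed.

Let muV q : measurable_fun setT (fun x => u x `^ q).
Proof. exact: (measurableT_comp (@measurable_powR R q) mu). Qed.

Let uZ r x : 0 < r -> u (scale_tuple (Num.sqrt r) x) = r * u x.
Proof. by move=> r0; rewrite /u enorm_scale ?sqrtr_ge0// exprMn sqr_sqrtr ?ltW. Qed.

(** An auxiliary variable r is attached to the integrand h(x) g(|x|^2). The factor k(r / |x|^2) /
    |x|^2, with k the radial kernel, has an r-integral that does not depend on x when x is
    nonzero. *)
Let F (z : measurableTypeR R * n.-tuple R) :=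
  (h z.2 * g (u z.2) * (radial_kernel (z.1 * u z.2 `^ (-1)) * u z.2 `^ (-1)))%:E.

(** This is [F] after the substitution x = sqrt(r) y, Jacobian included. The kernel then depends on
    y alone and [g] on r |y|^2. *)
Let G (z : measurableTypeR R * n.-tuple R) :=
  ((h z.2 * radial_kernel (u z.2 `^ (-1)) * u z.2 `^ (-1)) *
   (z.1 `^ p * g (z.1 * u z.2)))%:E.

Let F_ge0 z : (0 <= F z)%E.
Proof. by rewrite lee_fin !mulr_ge0 ?powR_ge0 ?radial_kernel_ge0. Qed.

Let G_ge0 z : (0 <= G z)%E.
Proof. by rewrite lee_fin !mulr_ge0 ?powR_ge0 ?radial_kernel_ge0. Qed.

Let mF : measurable_fun setT F.
Proof.
apply/measurable_EFinP; apply: measurable_funM; apply: measurable_funM.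
- exact: measurableT_comp.
- by apply: (measurableT_comp mg); exact: measurableT_comp.
- apply: (measurableT_comp (@measurable_radial_kernel R)).
  by apply: measurable_funM => //; exact: (measurableT_comp (muV _)).
- exact: (measurableT_comp (muV _)).
Qed.

Let mG : measurable_fun setT G.
Proof.
apply/measurable_EFinP; apply: measurable_funM; apply: measurable_funM.
- apply: measurable_funM; first exact: measurableT_comp.
  apply: (measurableT_comp (@measurable_radial_kernel R)).
  exact: (measurableT_comp (muV _)).
- exact: (measurableT_comp (muV _)).
- exact: (measurableT_comp (@measurable_powR R p)).
- apply: (measurableT_comp mg).
  by apply: measurable_funM => //; exact: (measurableT_comp mu).
Qed.

(** Substitution v = r / |x|^2. At the origin both sides vanish because [g] is 0 there. *)
Let intF2 x : (\int[lebesgue_measure]_r F (r, x) =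
  (h x * g (u x))%:E * \int[lebesgue_measure]_v (radial_kernel v)%:E)%E.
Proof.
have [ux0|ux0] := leP (u x) 0.
  rewrite gneg// mulr0 mul0e integral0_eq// => r _.
  by rewrite /F/= gneg// mulr0 mul0r.
rewrite (@ge0_integral_scale R (u x `^ (-1))
  (fun v => (radial_kernel v)%:E)) ?powR_gt0//; first last.
- by move=> v; rewrite lee_fin radial_kernel_ge0.
- by apply/measurable_EFinP; exact: measurable_radial_kernel.
have mk : measurable_fun setT (fun r : R => (radial_kernel (u x `^ (-1) * r))%:E).
  apply/measurable_EFinP; apply: (measurableT_comp (@measurable_radial_kernel R)).
  exact: measurable_funM.
rewrite -ge0_integralZl//; first last.
- by rewrite lee_fin powR_ge0.
- by move=> v _; rewrite lee_fin radial_kernel_ge0.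
rewrite -ge0_integralZl//; first last.
- by rewrite lee_fin mulr_ge0.
- by move=> v _; rewrite mule_ge0// lee_fin ?powR_ge0 ?radial_kernel_ge0.
- exact: measurable_funeM.
apply: eq_integral => r _; rewrite /F/= -!EFinM; congr EFin.
by rewrite [r * _]mulrC; ring.
Qed.

(** Substitution x = sqrt(r) y, under which [h] does not change. The Jacobian r^(n/2) meets the
    factor 1/r coming from 1/|x|^2, and r^p remains. *)
Let intFG r : (\int[lebesgue_tuple R n]_x F (r, x) =
  \int[lebesgue_tuple R n]_y G (r, y))%E.
Proof.
(* For r <= 0 both integrands vanish: [F] because the argument of the kernel is nonpositive, [G]
   because that of [g] is. *)
have [r0|r0] := leP r 0.
  apply: eq_integral => x _; rewrite /F /G /=; congr EFin.
  rewrite radial_kernel_le0 ?mulr_le0_ge0 ?powR_ge0// (gneg (s := r * _)) ?mulr_le0_ge0//.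
  by rewrite mul0r !mulr0.
have mFr : measurable_fun setT (fun x => F (r, x)).
  by apply: (measurableT_comp mF); exact: pair1_measurable.
rewrite (@ge0_integral_scale_tuple R n (Num.sqrt r)) ?sqrtr_gt0//.
have mFs : measurable_fun setT (fun x => F (r, scale_tuple (Num.sqrt r) x)).
  by apply: (measurableT_comp mFr); exact: measurable_scale_tuple.
rewrite -ge0_integralZl//.
apply: eq_integral => y _; rewrite /F /G /= -EFinM; congr EFin.
have [uy0|uy0] := leP (u y) 0.
  rewrite uZ// (gneg (s := r * u y)) ?(mulr_ge0_le0 (ltW r0))//.
  by rewrite !(mulr0, mul0r).
rewrite hZ ?sqrtr_gt0// uZ//.
have ru0 := mulr_ge0 (ltW r0) (ltW uy0).
have -> : r * (r * u y) `^ (-1) = u y `^ (-1).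
  rewrite !powR_inv1//.
  by field; rewrite !gt_eqF.
have -> : Num.sqrt r ^+ n = r * r `^ p.
  rewrite /p powRB ?(gt_eqF r0) ?implybT// powRr1 ?ltW//.
  rewrite mulrCA divff ?gt_eqF// mulr1 mulrC powRrM powR_mulrn ?powR_ge0//.
  by rewrite powR12_sqrt ?ltW.
rewrite !powR_inv1//.
by field; rewrite !gt_eqF.
Qed.

(** Substitution s = r |y|^2, which produces the factor |y|^(-2(p + 1)), that is, the power -n/2 of
    |y|^2. *)
Let intG1 y : (\int[lebesgue_measure]_r G (r, y) =
  (h y * radial_kernel (u y `^ (-1)) * u y `^ (-1) * u y `^ (- (n%:R / 2)))%:E *
  \int[lebesgue_measure]_s (s `^ p * g s)%:E)%E.
Proof.
(* At the origin the power 0^(-1) is 0 by convention, and the kernel vanishes at 0. *)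
have [uy0|uy0] := leP (u y) 0.
  have /eqP uy : u y == 0 by rewrite eq_le uy0 u_ge0.
  rewrite radial_kernel_le0 ?mulr0 ?mul0r ?mul0e; last first.
    by rewrite uy powR0// oppr_eq0 oner_neq0.
  rewrite integral0_eq// => r _; rewrite /G/= radial_kernel_le0 ?(mulr0,mul0r)//.
  by rewrite uy powR0// oppr_eq0 oner_neq0.
have mK : measurable_fun setT (fun s : R => (s `^ p * g s)%:E).
  by apply/measurable_EFinP; apply: measurable_funM => //; exact: measurable_powR.
rewrite (@ge0_integral_scale R (u y) (fun s => (s `^ p * g s)%:E))//; last first.
  by move=> s; rewrite lee_fin mulr_ge0 ?powR_ge0.
have mKu : measurable_fun setT (fun s : R => ((u y * s) `^ p * g (u y * s))%:E).
  by apply: (measurableT_comp mK); exact: measurable_funM.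
rewrite -ge0_integralZl//; first last.
- by rewrite lee_fin ltW.
- by move=> s _; rewrite lee_fin mulr_ge0 ?powR_ge0.
rewrite -ge0_integralZl//; first last.
- by rewrite lee_fin !mulr_ge0 ?powR_ge0 ?radial_kernel_ge0.
- by move=> s _; rewrite -EFinM lee_fin (mulr_ge0 (ltW uy0))// mulr_ge0 ?powR_ge0.
- exact: measurable_funeM.
apply: eq_integral => r _; rewrite /G/= -!EFinM; congr EFin.
have [r0|r0] := leP r 0.
  have ur := mulr_ge0_le0 (ltW uy0) r0.
  by rewrite [r * _]mulrC (gneg ur) !mulr0.
rewrite powRM ?(ltW r0)// (powRN _ (n%:R / 2)) [r * _]mulrC.
have -> : u y `^ (n%:R / 2) = u y * u y `^ p.
  rewrite /p powRB ?(gt_eqF uy0) ?implybT// powRr1//.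
  by rewrite mulrCA divff ?gt_eqF// mulr1.
by field; rewrite !gt_eqF// ?powR_gt0.
Qed.

(** The double integral of [F] is computed twice. Integrating in r first gives the left-hand side.
    Integrating in x first allows [F] to be replaced by [G], and a second use of Tonelli puts r
    first again, which gives the right-hand side. *)
Lemma polar_integral :
  (\int[lebesgue_measure]_v (radial_kernel v)%:E *
     \int[lebesgue_tuple R n]_x (h x * g (enorm x ^+ 2))%:E =
   directional_mass *
     \int[lebesgue_measure]_(s in `]0%R, +oo[) (s `^ (n%:R / 2 - 1) * g s)%:E)%E.
Proof.
have mgu : measurable_fun setT (fun x => (h x * g (u x))%:E).
  by apply/measurable_EFinP; apply: measurable_funM => //; exact: measurableT_comp.
rewrite muleC -ge0_integralZr//; first last.
- by apply: integral_ge0 => v _; rewrite lee_fin radial_kernel_ge0.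
- by move=> x _; rewrite lee_fin mulr_ge0.
under eq_integral do rewrite -intF2.
rewrite -(fubini_tonelli F)//.
under eq_integral do rewrite intFG.
rewrite (fubini_tonelli G)//.
under eq_integral do rewrite intG1.
rewrite ge0_integralZr//.
- congr (_ * _)%E; rewrite [RHS]integral_mkcond; apply: eq_integral => s _.
  rewrite patchE; case: ifPn => // /negP; rewrite inE/= in_itv/= andbT => /negP.
  by rewrite -leNgt => s0; rewrite gneg ?mulr0.
- apply/measurable_EFinP; apply: measurable_funM; last exact: muV.
  apply: measurable_funM; last exact: muV.
  apply: measurable_funM => //.
  exact: (measurableT_comp (@measurable_radial_kernel R) (muV _)).
- by move=> x _; rewrite lee_fin !mulr_ge0 ?powR_ge0 ?radial_kernel_ge0.
- by apply: integral_ge0 => v _; rewrite lee_fin mulr_ge0 ?powR_ge0.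
Qed.

End polar.

(** * The Euclidean norm and Gaussian integrals *)

Lemma enorm_sqr (R : realType) (n : nat) (x : n.-tuple R) :
  enorm x ^+ 2 = \sum_(i < n) tnth x i ^+ 2.
Proof. by rewrite sqr_sqrtr// sumr_ge0// => i _; exact: sqr_ge0. Qed.

Lemma normr_tnth_le_enorm (R : realType) (n : nat) (x : n.-tuple R) (i : 'I_n) :
  `|tnth x i| <= enorm x.
Proof.
rewrite -sqrtr_sqr ler_sqrt; last by rewrite sumr_ge0// => j _; exact: sqr_ge0.
by rewrite (bigD1 i)//= lerDl sumr_ge0// => j _; exact: sqr_ge0.
Qed.

Lemma enorm_eq0_tnth (R : realType) (n : nat) (x : n.-tuple R) (i : 'I_n) :
  enorm x = 0 -> tnth x i = 0.
Proof.
move=> x0; apply/normr0_eq0/eqP.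
by rewrite eq_le normr_ge0 andbT -x0 normr_tnth_le_enorm.
Qed.

(** By evenness this is twice the integral over the half-line, where -e^(-t^2)/2 is an
    antiderivative. *)
Lemma integral_abs_gauss (R : realType) :
  (\int[lebesgue_measure]_t (`|t| * gauss_fun t : R)%:E = 1)%E.
Proof.
have cg : continuous (fun t : R => `|t| * gauss_fun t).
  move=> t; apply: cvgM; [exact: norm_continuous|exact: continuous_gauss_fun].
rewrite ge0_symfun_integralT//; last 2 first.
- by move=> t; rewrite mulr_ge0 ?gauss_fun_ge0.
- by move=> t; rewrite /= normrN /gauss_fun sqrrN.
rewrite (_ : [set x | _] = `[0, +oo[%classic); last first.
  by apply/seteqP; split => x/=; rewrite in_itv/= andbT.
pose F (t : R) := - (2^-1 * gauss_fun t).
have dF (x : R) : is_derive x 1 F (x * gauss_fun x).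
  rewrite /F /gauss_fun; apply: is_derive_eq.
  by rewrite /GRing.scale/=; field.
rewrite (@ge0_continuous_FTC2y _ _ F 0 0).
- by rewrite /F /gauss_fun expr0n/= oppr0 expR0 mulr1 -EFinB sub0r opprK -EFinM divff.
- by move=> x _; rewrite mulr_ge0 ?gauss_fun_ge0.
- exact: continuous_subspaceT.
- rewrite -oppr0 -(mulr0 2^-1); apply: cvgN; apply: cvgM; first exact: cvg_cst.
  exact: cvg_gauss_fun.
- by move=> x _; have := dF x; case.
- apply: cvg_at_right_filter; apply: differentiable_continuous.
  by apply/derivable1_diffP; have := dF 0; case.
- move=> x; rewrite in_itv/= andbT => x0; rewrite derive1E.
  by rewrite (@derive_val _ _ _ _ _ _ _ (dF x)) gtr0_norm.
Qed.

Lemma measurable_gaussM (R : realType) (phi : R -> R) :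
  measurable_fun setT phi ->
  measurable_fun setT (fun t : R => (phi t * gauss_fun t)%:E).
Proof.
move=> mphi; apply/measurable_EFinP; apply: measurable_funM => //.
exact: measurable_gauss_fun.
Qed.

(** Positivity and finiteness suffice here: the mean of x_i^2 over the sphere is found later from
    the fact that these squares sum to 1. Finiteness comes from t^2 e^(-t^2) <= 2 e^(-t^2/2),
    positivity from comparison with the first absolute moment. *)
Lemma integral_sqr_gauss (R : realType) : exists2 A : R, 0 < A &
  (\int[lebesgue_measure]_t (t ^+ 2 * gauss_fun t : R)%:E = A%:E)%E.
Proof.
set I := (X in exists2 A, _ & X = A%:E).
have m2 : measurable_fun setT (fun t : R => (t ^+ 2 * gauss_fun t)%:E).
  by apply: measurable_gaussM; exact: measurable_funX.
have mg : measurable_fun setT (fun t : R => (gauss_fun t)%:E).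
  by apply/measurable_EFinP; exact: measurable_gauss_fun.
have I0 : (0 <= I)%E.
  by apply: integral_ge0 => t _; rewrite lee_fin mulr_ge0 ?sqr_ge0 ?gauss_fun_ge0.
have Ioo : (I < +oo)%E.
  (* With this [a], e^(-t^2/2) is [gauss_fun (a * t)], so its integral is finite by scaling. *)
  pose a : R := (Num.sqrt 2)^-1.
  have a0 : 0 < a by rewrite invr_gt0 sqrtr_gt0.
  have a2 : a ^+ 2 = 2^-1 by rewrite exprVn sqr_sqrtr.
  have mga : measurable_fun setT (fun t : R => (gauss_fun (a * t))%:E).
    by apply: (measurableT_comp mg); exact: measurable_funM.
  have ga : (\int[lebesgue_measure]_t (gauss_fun (a * t))%:E < +oo)%E.
    rewrite ltey; apply/eqP => J.
    have := ge0_integral_scale a0 mg (fun t => gauss_fun_ge0 t).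
    by rewrite integralT_gauss J gt0_muley// lte_fin.
  apply: (@le_lt_trans _ _ (2%:E * \int[lebesgue_measure]_t (gauss_fun (a * t))%:E)%E).
    rewrite -ge0_integralZl//.
    - apply: ge0_le_integral => //.
      + by move=> t _; rewrite lee_fin mulr_ge0 ?sqr_ge0 ?gauss_fun_ge0.
      + exact: measurable_funeM.
      + move=> t _; rewrite -EFinM lee_fin /gauss_fun.
        rewrite exprMn a2; set s := t ^+ 2.
        rewrite [in leLHS](_ : - s = - (2^-1 * s) - (2^-1 * s)); last by field.
        rewrite expRD mulrCA mulrC ler_wpM2r ?expR_ge0// expRN.
        rewrite mulrC ler_pdivrMl ?expR_gt0//.
        by have := expR_ge1Dx (2^-1 * s); lra.
    - by move=> t _; rewrite lee_fin gauss_fun_ge0.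
  by rewrite lte_mul_pinfty// lee_fin.
have If : I \is a fin_num by rewrite ge0_fin_numE.
exists (fine I); last by rewrite fineK.
(* Integrating |t| <= (t^2 + 1)/2 against the Gaussian gives 1 <= (I + sqrt pi)/2. Since sqrt pi <
   2, this forces I > 0. *)
have : (1 <= (2^-1)%:E * (I + (Num.sqrt pi)%:E))%E.
  rewrite -integral_abs_gauss -integralT_gauss -ge0_integralD//; first last.
  - by move=> t _; rewrite lee_fin gauss_fun_ge0.
  - by move=> t _; rewrite lee_fin mulr_ge0 ?sqr_ge0 ?gauss_fun_ge0.
  rewrite -ge0_integralZl//.
  - apply: ge0_le_integral => //.
    + by move=> t _; rewrite lee_fin mulr_ge0 ?gauss_fun_ge0.
    + by apply: measurable_gaussM; exact: normr_measurable.
    + by apply: measurable_funeM; exact: emeasurable_funD.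
    + move=> t _; rewrite -EFinD -EFinM lee_fin.
      have := gauss_fun_ge0 t; have : `|t| <= 2^-1 * (t ^+ 2 + 1).
        rewrite -[t ^+ 2]ger0_norm ?sqr_ge0// normrX.
        by have := sqr_ge0 (`|t| - 1); nra.
      by nra.
  - exact: emeasurable_funD.
  - move=> t _; rewrite adde_ge0// lee_fin ?gauss_fun_ge0//.
    by rewrite mulr_ge0 ?sqr_ge0 ?gauss_fun_ge0.
rewrite -(fineK If) -EFinD -EFinM lee_fin.
have : Num.sqrt pi < 2 :> R.
  rewrite -[ltRHS](@ger0_norm R)// -sqrtr_sqr ltr_sqrt ?exprn_gt0//.
  by have := @pihalf_lt2 R; lra.
lra.
Qed.

Lemma expR_enorm (R : realType) (n : nat) (x : n.-tuple R) :
  expR (- enorm x ^+ 2) = \prod_i gauss_fun (tnth x i).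
Proof.
by rewrite enorm_sqr -sumrN expR_sum.
Qed.

(** The Gaussian factors over the coordinates: coordinate [i] contributes [A], and each of the other
    n - 1 contributes sqrt pi. *)
Lemma integral_gauss_tuple (R : realType) (n : nat) (i : 'I_n) (phi : R -> R)
    (A : R) :
  measurable_fun setT phi -> (forall t, 0 <= phi t) ->
  (\int[lebesgue_measure]_t (phi t * gauss_fun t)%:E = A%:E)%E ->
  (\int[lebesgue_tuple R n]_x (phi (tnth x i) * expR (- enorm x ^+ 2))%:E =
   (A * Num.sqrt pi ^+ n.-1)%:E)%E.
Proof.
move=> mphi phi0 phiA.
pose f (j : 'I_n) t := (if j == i then phi t else 1) * gauss_fun t.
pose c (j : 'I_n) := if j == i then A else Num.sqrt pi.
rewrite (eq_integral (fun x : n.-tuple R => (\prod_j f j (tnth x j))%:E)); last first.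
  move=> x _; rewrite expR_enorm /f big_split/=; congr ((_ * _)%:E).
  rewrite (bigD1 i)//= eqxx big1 ?mulr1// => j /negPf ->//.
rewrite (@ge0_integral_tuple_prod R n f c).
- congr EFin; rewrite /c (bigD1 i)//= eqxx; congr (_ * _).
  rewrite (eq_bigr (fun=> Num.sqrt pi)) => [|j /negPf ->//].
  by rewrite prodr_const cardC1 card_ord.
- move=> j; apply: measurable_funM; last exact: measurable_gauss_fun.
  by case: (j == i).
- by move=> j t; rewrite mulr_ge0 ?gauss_fun_ge0//; case: (j == i).
- move=> j; rewrite /f /c; case: (j == i) => //.
  by under eq_integral do rewrite mul1r; exact: integralT_gauss.
Qed.

(** * The null origin, and surface integrals as ball integrals *)

(** The indicator of the origin is the product of the indicators of 0 in each coordinate, and each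
    of these has integral 0. In dimension 0 the measure is a Dirac mass, hence the condition on
    [n]. *)
Lemma lebesgue_tuple_enorm0 (R : realType) (n : nat) : (0 < n)%N ->
  lebesgue_tuple R n [set x | enorm x = 0] = 0%E /\
  measurable [set x : n.-tuple R | enorm x = 0].
Proof.
move=> n0.
have mN : measurable [set x : n.-tuple R | enorm x = 0].
  rewrite (_ : [set x | _] = setT `&` @enorm R n @^-1` [set 0]).
    exact: measurable_enorm.
  by rewrite setTI.
split => //.
rewrite -[X in lebesgue_tuple R n X]setIT -integral_indic//.
rewrite (eq_integral (fun x : n.-tuple R => (\prod_i (\1_[set 0] (tnth x i)))%:E)).
  rewrite (@ge0_integral_tuple_prod R n (fun=> \1_[set 0]) (fun=> 0)).
  - by rewrite prodr_const card_ord expr0n (gtn_eqF n0).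
  - by move=> i; exact: measurable_indic.
  - by move=> i t; rewrite indicE.
  - move=> i; rewrite integral_indic// setIT; exact: lebesgue_measure_set1.
move=> x _; congr EFin; rewrite indicE.
case: (boolP (x \in _)) => [|].
  rewrite inE/= => x0; rewrite big1// => i _; rewrite indicE mem_set//=.
  exact: enorm_eq0_tnth.
rewrite notin_setE/= => x0; apply/esym/eqP.
apply: contra_notT x0 => /prodf_neq0 x0.
rewrite /enorm big1 ?sqrtr0// => i _.
have := x0 i isT; rewrite indicE; case: (boolP (_ \in _)); last by rewrite eqxx.
by rewrite inE/= => -> _; rewrite expr0n.
Qed.

Definition normalize (R : realType) (n : nat) (x : n.-tuple R) : n.-tuple R :=
  scale_tuple (enorm x)^-1 x.

Lemma normalizeZ (R : realType) (n : nat) (a : R) (x : n.-tuple R) : 0 < a ->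
  normalize (scale_tuple a x) = normalize x.
Proof.
move=> a0; rewrite /normalize enorm_scale ?ltW//.
apply: eq_from_tnth => i; rewrite !tnth_mktuple invfM.
by rewrite mulrACA mulrA mulVf ?gt_eqF// mul1r.
Qed.

Lemma measurable_sphere (R : realType) (n : nat) : measurable (sphere R n).
Proof.
rewrite (_ : sphere R n = setT `&` @enorm R n @^-1` [set 1]).
  exact: measurable_enorm.
by rewrite setTI.
Qed.

(** By [coneE], surface measure is [n] times the image under [normalize] of Lebesgue measure on the
    punctured unit ball. The ball is written through |x|^2 so as to fit the shape g(|x|^2) of the
    polar identity. *)
Lemma ge0_integral_surface (R : realType) (n : nat) (f : n.-tuple R -> R) :
  measurable_fun setT f -> (forall x, 0 <= f x) ->
  (\int[surface_measure R n]_(x in sphere R n) (f x)%:E =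
   n%:R%:E * \int[lebesgue_tuple R n]_x
     (f (normalize x) * \1_`]0%R, 1%R] (enorm x ^+ 2))%:E)%E.
Proof.
move=> mf f0.
have mN : measurable_fun setT (@normalize R n) by exact: measurable_normalize.
pose B := [set x : n.-tuple R | 0 < enorm x <= 1].
have mB : measurable B.
  rewrite (_ : B = setT `&` @enorm R n @^-1` `]0, 1]%classic).
    by apply: measurable_enorm.
  by rewrite setTI; apply/seteqP; split => x /=; rewrite in_itv.
pose nu := mrestr (lebesgue_tuple R n) mB.
pose m := mscale (NngNum (ler0n R n)) (pushforward nu (@normalize R n))
  : {measure set (n.-tuple R) -> \bar R}.
rewrite (eq_measure_integral (m mN)); last first.
  move=> A mA _; rewrite /m/= /mscale/= /pushforward/= /mrestr.
  by rewrite [LHS]/surface_measure coneE setIC.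
have mEf : measurable_fun setT (EFin \o f) by exact/measurable_EFinP.
have mEfN : measurable_fun setT (fun x => (f (normalize x))%:E).
  by apply: (measurableT_comp mEf).
rewrite ge0_integral_mscale//; first last.
- by move=> x _; rewrite lee_fin.
- exact: measurable_funTS.
- exact: measurable_sphere.
congr (_ * _)%E.
rewrite ge0_integral_pushforward//; first last.
- by move=> x _; rewrite lee_fin.
- exact: measurable_funTS.
- exact: measurable_sphere.
have mE : measurable (@normalize R n @^-1` sphere R n).
  by rewrite -[X in measurable X]setTI; apply: mN => //; exact: measurable_sphere.
(* [nu] gives no mass to the complement of [B], and every point of [B] normalizes into the sphere,
   so the domain becomes [B]. *)
rewrite (@ge0_negligible_integral _ _ _ _ _ (~` B))//; first last.
- by rewrite /nu/= /mrestr setICl measure0.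
- by move=> x _; rewrite lee_fin.
- exact: measurable_funTS.
- exact: measurableC.
rewrite setDE setCK.
rewrite (_ : _ `&` B = B); last first.
  apply/setIidPr => x /= /andP[x0 _].
  by rewrite /sphere/= enorm_scale ?invr_ge0 ?ltW// mulVf ?gt_eqF.
rewrite (eq_measure_integral (lebesgue_tuple R n)); last first.
  by move=> A mA AB; rewrite /nu/= /mrestr setIidl.
rewrite integral_mkcond; apply: eq_integral => x _.
rewrite patchE /= indicE.
have -> : (enorm x ^+ 2 \in `]0, 1]%classic) = (x \in B).
  apply/idP/idP; rewrite !inE /B/= in_itv/=.
    rewrite exprn_even_gt0//= => /andP[x0 x1].
    rewrite lt_neqAle eq_sym x0 sqrtr_ge0/=.
    by rewrite -(@ler_pXn2r _ 2)// ?nnegrE ?sqrtr_ge0// expr1n.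
  move=> /andP[x0 x1]; rewrite exprn_gt0//=.
  by rewrite exprn_ile1 ?sqrtr_ge0.
by case: ifPn => _; rewrite (mulr1, mulr0).
Qed.

(** * Directional mass and the total surface of the sphere *)

(** A factor 0 would make the product 0, and an infinite factor beside a positive one would make it
    infinite. Applied to the polar identity, this yields finiteness of the directional mass and of
    the radial integral together. *)
Lemma mule_eq_pos_fin (R : realType) (a b : \bar R) (r : R) :
  (0 <= a)%E -> (0 <= b)%E -> 0 < r -> (a * b = r%:E)%E ->
  [/\ 0 < fine a, 0 < fine b, a = (fine a)%:E & b = (fine b)%:E].
Proof.
move=> a0 b0 r0 ab.
have agt0 : (0 < a)%E.
  rewrite lt_neqAle a0 andbT; apply/eqP => a00; move: ab.
  by rewrite -a00 mul0e => -[r00]; move: r0; rewrite -r00 ltxx.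
have bgt0 : (0 < b)%E.
  rewrite lt_neqAle b0 andbT; apply/eqP => b00; move: ab.
  by rewrite -b00 mule0 => -[r00]; move: r0; rewrite -r00 ltxx.
case: a b agt0 bgt0 ab {a0 b0} => [a| |] [b| |]//=; rewrite ?lte_fin.
- by move=> a0 _; rewrite gt0_muley ?lte_fin.
- by move=> _ b0; rewrite gt0_mulye ?lte_fin.
Qed.

Lemma directional_mass_ge0 (R : realType) (n : nat) (h : n.-tuple R -> R) :
  (forall x, 0 <= h x) -> (0 <= directional_mass h)%E.
Proof.
move=> h0; apply: integral_ge0 => x _.
by rewrite lee_fin !mulr_ge0 ?powR_ge0 ?radial_kernel_ge0.
Qed.

(** The integrand is at most the indicator of []0, 1]] and at least (1/2)^p times the indicator of
    []1/2, 1]]. *)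
Lemma integral_powR_unit (R : realType) (p : R) : 0 <= p ->
  exists2 c : R, 0 < c & (\int[lebesgue_measure]_(s in `]0%R, +oo[)
     (s `^ p * \1_`]0%R, 1%R] s)%:E = c%:E)%E.
Proof.
move=> p0.
have mp : measurable_fun setT (fun s : R => (s `^ p * \1_`]0%R, 1%R] s)%:E).
  apply/measurable_EFinP; apply: measurable_funM; first exact: measurable_powR.
  exact: measurable_indic.
have mi (i : interval R) : measurable_fun setT (fun s : R => (\1_[set` i] s : R)%:E).
  by apply/measurable_EFinP; exact: measurable_indic.
set I := (X in exists2 c, _ & X = c%:E).
have I0 : (0 <= I)%E.
  by apply: integral_ge0 => s _; rewrite lee_fin mulr_ge0 ?powR_ge0// indicE.
have Ile : (I <= 1)%E.
  have <- : (\int[lebesgue_measure]_(s in `]0%R, +oo[) (\1_`]0%R, 1%R] s : R)%:E = 1)%E.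
    rewrite integral_indic// setIidl; last first.
      by move=> s /=; rewrite !in_itv/= => /andP[->].
    by rewrite [LHS]lebesgue_measure_itv/= lte_fin ltr01 -EFinB subr0.
  apply: ge0_le_integral => //.
  - by move=> s _; rewrite lee_fin mulr_ge0 ?powR_ge0// indicE.
  - exact: measurable_funTS.
  - by apply: measurable_funTS; exact: mi.
  - move=> s _; rewrite lee_fin indicE mem_setE.
    case: (boolP (s \in _)) => [|_]; last by rewrite mulr0.
    rewrite in_itv/= => /andP[s0 s1]; rewrite mulr1.
    have := ge0_ler_powR p0 (ltW s0 : s \is Num.nneg) (ler01 : (1 : R) \is Num.nneg) s1.
    by rewrite powR1.
have Ige : ((2^-1 `^ p * 2^-1)%:E <= I)%E.
  have <- : (\int[lebesgue_measure]_(s in `]0%R, +oo[)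
      ((2^-1 `^ p)%:E * (\1_`]2^-1%R, 1%R] s : R)%:E) = (2^-1 `^ p * 2^-1)%:E)%E.
    rewrite ge0_integralZl//; first last.
    - by apply: measurable_funTS; exact: mi.
    rewrite integral_indic// setIidl; last first.
      by move=> s /=; rewrite !in_itv/= => /andP[s0 _]; lra.
    rewrite [X in (_ * X)%E]lebesgue_measure_itv/= lte_fin invf_lt1// ltr1n.
    by rewrite -EFinB -EFinM; congr EFin; congr (_ * _); lra.
  apply: ge0_le_integral => //.
  - by apply: measurable_funeM; apply: measurable_funTS; exact: mi.
  - exact: measurable_funTS.
  - move=> s _; rewrite -EFinM lee_fin !indicE !mem_setE.
    case: (boolP (s \in `]2^-1, 1])) => [|_]; last first.
      by rewrite mulr0 mulr_ge0 ?powR_ge0.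
    rewrite !in_itv/= => /andP[s0 s1]; rewrite s1 (lt_trans _ s0)// !mulr1.
    by rewrite ge0_ler_powR ?nnegrE// ltW// (lt_trans _ s0).
have If : (I \is a fin_num).
  by rewrite ge0_fin_numE// (le_lt_trans Ile)// ltry.
exists (fine I); last by rewrite fineK.
by rewrite -lte_fin fineK// (lt_le_trans _ Ige)// lte_fin mulr_gt0 ?powR_gt0.
Qed.

(** The polar identity with [g] the indicator of []0, 1]]. The constant is chosen before [h], so it
    cancels in quotients; [2 <= n] makes the exponent n/2 - 1 nonnegative. *)
Lemma ball_integral_directional_mass (R : realType) (n : nat) : (2 <= n)%N ->
  exists2 k : R, 0 < k & forall h : n.-tuple R -> R,
    measurable_fun setT h -> (forall x, 0 <= h x) ->
    (forall a x, 0 < a -> h (scale_tuple a x) = h x) ->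
    (\int[lebesgue_tuple R n]_x (h x * \1_`]0%R, 1%R] (enorm x ^+ 2))%:E =
     k%:E * directional_mass h)%E.
Proof.
move=> n2; have [c c0 cE] := integral_radial_kernel R.
have p0 : 0 <= n%:R / 2 - 1 :> R.
  by rewrite subr_ge0 ler_pdivlMr// mul1r ler_nat.
have [i i0 iE] := integral_powR_unit p0.
exists (c^-1 * i); first by rewrite mulr_gt0 ?invr_gt0.
move=> h mh h0 hZ.
have m1 : measurable_fun [set: R] (\1_`]0, 1] : R -> R) by exact: measurable_indic.
have := @polar_integral R n h \1_`]0, 1] mh h0 hZ m1.
rewrite cE iE => E; rewrite EFinM -muleA [(i%:E * _)%E]muleC -E//.
- by rewrite muleA -EFinM mulVf ?gt_eqF// mul1e.
- by move=> s s0; rewrite indicE memNset//= in_itv/= ltNge s0.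
Qed.

(** The indicator enforces vanishing on s <= 0, so that the identity applies to functions such as
    e^(-s). *)
Lemma polar_integral_gt0 (R : realType) (n : nat) (h : n.-tuple R -> R)
    (g : R -> R) :
  measurable_fun setT h -> (forall x, 0 <= h x) ->
  (forall a x, 0 < a -> h (scale_tuple a x) = h x) ->
  measurable_fun setT g -> (forall s, 0 <= g s) ->
  (\int[lebesgue_measure]_v (radial_kernel v)%:E *
     \int[lebesgue_tuple R n]_x
       (h x * (\1_`]0%R, +oo[ (enorm x ^+ 2) * g (enorm x ^+ 2)))%:E =
   directional_mass h *
     \int[lebesgue_measure]_(s in `]0%R, +oo[) (s `^ (n%:R / 2 - 1) * g s)%:E)%E.
Proof.
move=> mh h0 hZ mg g0.
rewrite (@polar_integral R n h (fun s => \1_`]0, +oo[ s * g s))//.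
- congr (_ * _)%E; apply: eq_integral => s; rewrite inE/= => s0.
  by rewrite indicE mem_set// mul1r.
- by apply: measurable_funM => //; exact: measurable_indic.
- by move=> s; rewrite mulr_ge0// indicE.
- by move=> s s0; rewrite indicE memNset ?mul0r//= in_itv/= andbT ltNge s0.
Qed.

Lemma integral_gauss_pos (R : realType) (n : nat) : (0 < n)%N ->
  (\int[lebesgue_tuple R n]_x (1 * (\1_`]0%R, +oo[ (enorm x ^+ 2) *
      expR (- enorm x ^+ 2)))%:E = (Num.sqrt pi ^+ n)%:E)%E.
Proof.
move=> n0; have [N0 mN] := lebesgue_tuple_enorm0 R n0.
have mu : measurable_fun setT (fun x : n.-tuple R => enorm x ^+ 2).
  by apply: measurable_funX; exact: measurable_enorm.
have me : measurable_fun setT (fun x : n.-tuple R => expR (- enorm x ^+ 2)).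
  by apply: (measurableT_comp (@measurable_expR R)); exact: measurableT_comp.
have := @integral_gauss_tuple R n (Ordinal n0) (cst 1) (Num.sqrt pi) _ _ _.
rewrite -exprS prednK// => <-//; last first.
  by under eq_integral do rewrite mul1r; exact: integralT_gauss.
rewrite (ge0_negligible_integral mN)//; first last.
- apply/measurable_EFinP; apply: measurable_funM => //; apply: measurable_funM => //.
  by apply: (measurableT_comp _ mu); exact: measurable_indic.
rewrite [RHS](ge0_negligible_integral mN)//; first last.
- by move=> x _; rewrite lee_fin mul1r expR_ge0.
- by apply/measurable_EFinP; exact: measurable_funM.
apply: eq_integral => x; rewrite inE => -[_ /= x0].
rewrite indicE mem_set ?mul1r//= in_itv/= andbT exprn_even_gt0//=.
exact/eqP.
Qed.

(** The polar identity with [h] = 1 and g(s) = e^(-s): the radial integral is Gamma(n/2), and the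
    Gaussian integral is (sqrt pi)^n. *)
Lemma directional_mass1 (R : realType) (n : nat) (c : R)
    (D := directional_mass (cst 1 : n.-tuple R -> R)) : (0 < n)%N -> 0 < c ->
  (\int[lebesgue_measure]_v (radial_kernel v)%:E = c%:E)%E ->
  [/\ 0 < fine D, D = (fine D)%:E &
      c * Num.sqrt pi ^+ n = fine D * Gamma (n%:R / 2)].
Proof.
move=> n0 c0 cE.
have mexp : measurable_fun setT (fun s : R => expR (- s)).
  by apply: (measurableT_comp (@measurable_expR R)).
have m1 : measurable_fun setT (cst 1 : n.-tuple R -> R) by [].
have E := @polar_integral_gt0 R n (cst 1) _ m1 (fun=> ler01)
  (fun _ _ _ => erefl) mexp (fun s => expR_ge0 _).
rewrite cE integral_gauss_pos// -EFinM in E.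
have spi : 0 < Num.sqrt pi ^+ n :> R by rewrite exprn_gt0// sqrtr_gt0 pi_gt0.
have [|d0 G0 dE GE] := mule_eq_pos_fin
  (@directional_mass_ge0 R n (cst 1) (fun=> ler01)) _ (mulr_gt0 c0 spi) (esym E).
  by apply: integral_ge0 => s _; rewrite lee_fin mulr_ge0 ?powR_ge0 ?expR_ge0.
by rewrite dE GE -EFinM in E; case: E => E.
Qed.

(** A single [k] serves every [f] and the total surface alike, so a mean over the sphere becomes a
    quotient of two directional masses. *)
Lemma surface_sphereE (R : realType) (n : nat) : (2 <= n)%N ->
  exists2 k : R, 0 < k & forall f : n.-tuple R -> R,
    measurable_fun setT f -> (forall x, 0 <= f x) ->
    (\int[surface_measure R n]_(x in sphere R n) (f x)%:E =
     k%:E * directional_mass (f \o @normalize R n))%E /\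
    surface_measure R n (sphere R n) =
     (k%:E * directional_mass (cst 1%R : n.-tuple R -> R))%E.
Proof.
move=> n2; have [k k0 kE] := ball_integral_directional_mass R n2.
exists (n%:R * k); first by rewrite mulr_gt0// ltr0n ltnW.
move=> f mf f0; rewrite EFinM -!muleA; split.
  rewrite ge0_integral_surface//; congr (_ * _)%E; rewrite -kE//.
  - by apply: measurableT_comp => //; exact: measurable_normalize.
  - by move=> x; exact: f0.
  - by move=> a x a0; rewrite /= normalizeZ.
rewrite -[LHS]mul1e -integral_cst; last exact: measurable_sphere.
rewrite (@ge0_integral_surface R n (cst 1))//; congr (_ * _)%E.
by rewrite (kE (cst 1)).
Qed.

Lemma surface_sphere_gt0 (R : realType) (n : nat) : (2 <= n)%N ->
  surface_measure R n (sphere R n) \is a fin_num /\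
  0 < fine (surface_measure R n (sphere R n)).
Proof.
move=> n2; have [c c0 cE] := integral_radial_kernel R.
have [d0 dE _] := @directional_mass1 R n _ (ltnW n2) c0 cE.
have [k k0 /(_ (cst 1))[]// _ sE] := surface_sphereE R n2.
by rewrite sE dE -EFinM; split => //=; rewrite mulr_gt0.
Qed.

(** * Means of |x_i| and x_i^2 over the sphere *)

(** The mean is D(f o normalize) / D(1). The polar identity gives the numerator as c a / G, and
    [directional_mass1] gives the denominator as c (sqrt pi)^n / Gamma(n/2); the constant c
    cancels. *)
Lemma sphere_mean_polar (R : realType) (n : nat) (f : n.-tuple R -> R)
    (g : R -> R) (a : R) (G := \int[lebesgue_measure]_(s in `]0, +oo[)
      (s `^ (n%:R / 2 - 1) * g s)) : (2 <= n)%N ->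
  measurable_fun setT f -> (forall x, 0 <= f x) ->
  measurable_fun setT g -> (forall s, 0 <= g s) -> 0 < a ->
  (\int[lebesgue_tuple R n]_x (f (normalize x) *
     (\1_`]0%R, +oo[ (enorm x ^+ 2) * g (enorm x ^+ 2)))%:E = a%:E)%E ->
  0 < G /\ sphere_mean f = a * Gamma (n%:R / 2) / (Num.sqrt pi ^+ n * G).
Proof.
move=> n2 mf f0 mg g0 a0 aE.
have n0 : (0 < n)%N := ltnW n2.
have [c c0 cE] := integral_radial_kernel R.
have [k k0 /(_ f mf f0)[fE sE]] := surface_sphereE R n2.
have mh : measurable_fun setT (f \o @normalize R n).
  by apply: measurableT_comp => //; exact: measurable_normalize.
have hZ b x : 0 < b -> f (normalize (scale_tuple b x)) = f (normalize x).
  by move=> b0; rewrite normalizeZ.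
have E := polar_integral_gt0 mh (fun x => f0 _) hZ mg g0.
rewrite cE aE -EFinM in E.
have [|d0 G0 dE GE] := mule_eq_pos_fin
  (@directional_mass_ge0 R n (f \o @normalize R n) (fun x => f0 _)) _
  (mulr_gt0 c0 a0) (esym E).
  by apply: integral_ge0 => s _; rewrite lee_fin mulr_ge0 ?powR_ge0.
rewrite dE GE -EFinM in E; case: E => E.
have [d1 dE1 E1] := @directional_mass1 R n _ n0 c0 cE.
split; first exact: G0.
rewrite /sphere_mean /Rintegral fE sE dE dE1 -!EFinM.
move: (fine (directional_mass (f \o @normalize R n)))
  (fine (directional_mass (cst 1))) E E1 d0 d1 {dE dE1 sE fE} => d d' E E1 d0 d1.
change (c * a = d * G) in E.
change (is_true (0 < G)) in G0.
change (k * d / (k * d') = a * Gamma (n%:R / 2) / (Num.sqrt pi ^+ n * G)).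
have spi : 0 < Num.sqrt pi ^+ n :> R by rewrite exprn_gt0// sqrtr_gt0 pi_gt0.
have -> : k * d / (k * d') = d / d' by field; rewrite !gt_eqF.
apply/eqP; rewrite eqr_div ?(lt0r_neq0 d1) ?mulf_neq0 ?(lt0r_neq0 spi) ?(lt0r_neq0 G0)//.
apply/eqP.
apply: (mulfI (lt0r_neq0 c0)).
have -> : c * (d * (Num.sqrt pi ^+ n * G)) = (c * Num.sqrt pi ^+ n) * (d * G) by ring.
have -> : c * (a * Gamma (n%:R / 2) * d') = (c * a) * (d' * Gamma (n%:R / 2)) by ring.
by rewrite E E1 mulrC.
Qed.

Lemma measurable_tnth_comp (R : realType) (n : nat) (i : 'I_n) (phi : R -> R) :
  measurable_fun setT phi ->
  measurable_fun setT (fun x : n.-tuple R => phi (tnth x i)).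
Proof. by move=> mphi; apply: (measurableT_comp mphi); exact: measurable_tnth. Qed.

Lemma indic_pos_gt0 (R : realType) (s : R) : 0 < s -> \1_`]0, +oo[ s = 1 :> R.
Proof. by move=> s0; rewrite indicE mem_set//= in_itv/= s0. Qed.

(** With g(s) = sqrt(s) e^(-s), the factor |x| cancels the normalization of |x_i|, which leaves a
    product Gaussian integral. The extra power s^(1/2) turns the radial integral into
    Gamma((n+1)/2). *)
Lemma sphere_mean_abs_tnth (R : realType) (n : nat) (i : 'I_n) : (2 <= n)%N ->
  sphere_mean (fun x : n.-tuple R => `|tnth x i|) =
  Gamma (n%:R / 2) / (Num.sqrt pi * Gamma ((n%:R + 1) / 2)).
Proof.
move=> n2.
have spi : 0 < Num.sqrt pi :> R by rewrite sqrtr_gt0 pi_gt0.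
pose g (s : R) := s `^ 2^-1 * expR (- s).
have mg : measurable_fun setT g.
  apply: measurable_funM; first exact: measurable_powR.
  by apply: (measurableT_comp (@measurable_expR R)).
have g0 s : 0 <= g s by rewrite mulr_ge0 ?powR_ge0 ?expR_ge0.
have [||||G0 ->//] := @sphere_mean_polar R n (fun x => `|tnth x i|) g
    (1 * Num.sqrt pi ^+ n.-1) n2 _ _ mg g0.
- by apply: measurable_tnth_comp; exact: normr_measurable.
- by [].
- by rewrite mul1r exprn_gt0.
- rewrite -(@integral_gauss_tuple R n i Num.norm)//; last exact: integral_abs_gauss.
  apply: eq_integral => x _; congr EFin; rewrite tnth_mktuple.
  have [x0|x0] := eqVneq (enorm x) 0.
    by rewrite (enorm_eq0_tnth i x0) mulr0 normr0 !mul0r.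
  have {}x0 : 0 < enorm x by rewrite lt_neqAle eq_sym x0 sqrtr_ge0.
  rewrite indic_pos_gt0 ?exprn_gt0// /g powR12_sqrt ?sqr_ge0// sqrtr_sqr.
  rewrite normrM normfV (gtr0_norm x0) mul1r mulrA; congr (_ * _).
  by rewrite mulrAC mulVf ?mul1r// gt_eqF.
have GE : (\int[lebesgue_measure]_(s in `]0, +oo[) (s `^ (n%:R / 2 - 1) * g s)) =
    Gamma ((n%:R + 1) / 2).
  apply: eq_Rintegral => s; rewrite inE/= in_itv/= andbT => s0.
  rewrite /g mulrA -powRD ?(gt_eqF s0) ?implybT//; congr (_ `^ _ * _).
  by field.
rewrite GE.
have -> : Num.sqrt pi ^+ n = Num.sqrt pi * Num.sqrt pi ^+ n.-1 :> R.
  by rewrite -exprS prednK// ltnW.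
have G0' : 0 < Gamma ((n%:R + 1) / 2) :> R by rewrite -GE.
by field; rewrite ?expf_neq0 ?gt_eqF.
Qed.

(** Same method with s e^(-s). The absolute value in [g] keeps it nonnegative on the whole line. *)
Lemma sphere_mean_sqr_tnth_const (R : realType) (n : nat) : (2 <= n)%N ->
  exists k : R, forall i : 'I_n,
    sphere_mean (fun x : n.-tuple R => tnth x i ^+ 2) = k.
Proof.
move=> n2; have [A A0 AE] := integral_sqr_gauss R.
have spi : 0 < Num.sqrt pi :> R by rewrite sqrtr_gt0 pi_gt0.
pose g (s : R) := `|s| * expR (- s).
have mg : measurable_fun setT g.
  apply: measurable_funM; first exact: normr_measurable.
  by apply: (measurableT_comp (@measurable_expR R)).
have g0 s : 0 <= g s by rewrite mulr_ge0 ?expR_ge0.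
(* The witness is read off from [sphere_mean_polar]; it involves [A], [n] and [g] but not [i]. *)
eexists => i.
have [||||G0 ->//] := @sphere_mean_polar R n (fun x => tnth x i ^+ 2) g
    (A * Num.sqrt pi ^+ n.-1) n2 _ _ mg g0.
- by apply: (@measurable_tnth_comp _ _ i (fun t => t ^+ 2)); exact: measurable_funX.
- by move=> x; exact: sqr_ge0.
- by rewrite mulr_gt0 ?exprn_gt0.
- rewrite -(@integral_gauss_tuple R n i (fun t => t ^+ 2))//; last first.
    by move=> t; exact: sqr_ge0.
  apply: eq_integral => x _; congr EFin; rewrite tnth_mktuple.
  have [x0|x0] := eqVneq (enorm x) 0.
    by rewrite (enorm_eq0_tnth i x0) mulr0 expr0n !mul0r.
  have {}x0 : 0 < enorm x by rewrite lt_neqAle eq_sym x0 sqrtr_ge0.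
  rewrite indic_pos_gt0 ?exprn_gt0// /g ger0_norm ?sqr_ge0// mul1r mulrA.
  by congr (_ * _); field; rewrite gt_eqF.
Qed.

(** * Integrability, monotonicity and linearity of the spherical mean *)

Lemma integrable_surface (R : realType) (n : nat) (f : n.-tuple R -> R) (K : R) :
  (2 <= n)%N -> measurable_fun setT f ->
  (forall x, sphere R n x -> `|f x| <= K) ->
  (surface_measure R n).-integrable (sphere R n) (EFin \o f).
Proof.
move=> n2 mf fK; have [sfin _] := surface_sphere_gt0 R n2.
apply: measurable_bounded_integrable.
- exact: measurable_sphere.
- by rewrite -ge0_fin_numE.
- exact: measurable_funTS.
- exists K; split; first exact: num_real.
  by move=> y Ky x Sx; exact: le_trans (fK x Sx) (ltW Ky).
Qed.

Lemma eq_sphere_mean (R : realType) (n : nat) (f g : n.-tuple R -> R) :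
  (forall x, sphere R n x -> f x = g x) -> sphere_mean f = sphere_mean g.
Proof.
move=> fg; rewrite /sphere_mean; congr (_ / _).
by apply: eq_Rintegral => x; rewrite inE; exact: fg.
Qed.

Lemma sphere_mean_cst1 (R : realType) (n : nat) : (2 <= n)%N ->
  sphere_mean (cst 1 : n.-tuple R -> R) = 1.
Proof.
move=> n2; have [_ s0] := surface_sphere_gt0 R n2.
rewrite /sphere_mean Rintegral_cst; last exact: measurable_sphere.
by rewrite mul1r divff// gt_eqF.
Qed.

Lemma le_sphere_mean (R : realType) (n : nat) (f g : n.-tuple R -> R) :
  (2 <= n)%N ->
  (surface_measure R n).-integrable (sphere R n) (EFin \o f) ->
  (surface_measure R n).-integrable (sphere R n) (EFin \o g) ->
  (forall x, sphere R n x -> f x <= g x) -> sphere_mean f <= sphere_mean g.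
Proof.
move=> n2 If Ig fg; have [_ s0] := surface_sphere_gt0 R n2.
rewrite /sphere_mean ler_pM2r ?invr_gt0//.
by apply: le_Rintegral => //; exact: measurable_sphere.
Qed.

Lemma sphere_mean_lin (R : realType) (n : nat) (w : 'I_n -> R)
    (f : 'I_n -> n.-tuple R -> R) :
  (forall i, (surface_measure R n).-integrable (sphere R n) (EFin \o f i)) ->
  (surface_measure R n).-integrable (sphere R n)
    (EFin \o (fun x => \sum_i w i * f i x)) /\
  sphere_mean (fun x => \sum_i w i * f i x) = \sum_i w i * sphere_mean (f i).
Proof.
move=> If; have mS := @measurable_sphere R n.
(* Arbitrary index lists allow induction one summand at a time. Integrability is carried along
   because additivity of the integral requires it. *)
suff H (s : seq 'I_n) : (surface_measure R n).-integrable (sphere R n)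
    (EFin \o (fun x => \sum_(i <- s) w i * f i x)) /\
    (\int[surface_measure R n]_(x in sphere R n) (\sum_(i <- s) w i * f i x) =
     \sum_(i <- s) w i * \int[surface_measure R n]_(x in sphere R n) (f i x)).
  have [Is sE] := H (index_enum 'I_n); split => //.
  rewrite /sphere_mean sE mulr_suml.
  by apply: eq_bigr => i _; rewrite mulrA.
have IZ i : (surface_measure R n).-integrable (sphere R n)
    (EFin \o (fun x => w i * f i x)).
  by apply: eq_integrable (integrableZl mS (w i) (If i)).
elim: s => [|j s [Is IH]].
  split.
    apply: eq_integrable (integrable0 _ _) => // x _ /=.
    by rewrite big_nil.
  under eq_Rintegral do rewrite big_nil.
  by rewrite big_nil Rintegral_cst// mul0r.
split.
  apply: eq_integrable (integrableD mS (IZ j) Is) => // x _ /=.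
  by rewrite big_cons EFinD.
under eq_Rintegral do rewrite big_cons.
by rewrite RintegralD// RintegralZl// big_cons IH.
Qed.

Lemma sphere_sum_sqr (R : realType) (n : nat) (x : n.-tuple R) :
  sphere R n x -> \sum_(i < n) tnth x i ^+ 2 = 1.
Proof. by move=> x1; rewrite -enorm_sqr x1 expr1n. Qed.

Lemma sphere_tnth_le1 (R : realType) (n : nat) (x : n.-tuple R) (i : 'I_n) :
  sphere R n x -> `|tnth x i| <= 1.
Proof. by move=> x1; rewrite -x1 normr_tnth_le_enorm. Qed.

Lemma integrable_abs_tnth (R : realType) (n : nat) (i : 'I_n) : (2 <= n)%N ->
  (surface_measure R n).-integrable (sphere R n)
    (EFin \o (fun x => `|tnth x i|)).
Proof.
move=> n2; apply: (@integrable_surface R n _ 1) => // [|x Sx].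
  by apply: measurable_tnth_comp; exact: normr_measurable.
by rewrite normr_id sphere_tnth_le1.
Qed.

Lemma integrable_sqr_tnth (R : realType) (n : nat) (i : 'I_n) : (2 <= n)%N ->
  (surface_measure R n).-integrable (sphere R n)
    (EFin \o (fun x => tnth x i ^+ 2)).
Proof.
move=> n2; apply: (@integrable_surface R n _ 1) => // [|x Sx].
  by apply: (@measurable_tnth_comp _ _ i (fun t => t ^+ 2)); exact: measurable_funX.
by rewrite normrX exprn_ile1// sphere_tnth_le1.
Qed.

(** The [n] means share one value, and they sum to the mean of the constant 1. *)
Lemma sphere_mean_sqr_tnth (R : realType) (n : nat) (i : 'I_n) : (2 <= n)%N ->
  sphere_mean (fun x : n.-tuple R => tnth x i ^+ 2) = n%:R^-1.
Proof.
move=> n2; have [k kE] := sphere_mean_sqr_tnth_const R n2; rewrite kE.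
have [_] := @sphere_mean_lin R n (fun=> 1) (fun i x => tnth x i ^+ 2)
  (fun i => integrable_sqr_tnth R i n2).
rewrite (@eq_sphere_mean _ _ _ (cst 1)) => [|x Sx]; last first.
  by under eq_bigr do rewrite mul1r; exact: sphere_sum_sqr.
rewrite sphere_mean_cst1//; under eq_bigr do rewrite kE mul1r.
rewrite sumr_const card_ord => nk.
have n0 : n%:R != 0 :> R by rewrite pnatr_eq0 -lt0n ltnW.
by apply: (mulfI n0); rewrite divff// mulr_natl.
Qed.

(** * The lower and upper bounds *)

Section mean_norm_bounds.
Context (R : realType) (n : nat).
Hypothesis n2 : (2 <= n)%N.
Variable q : n.-tuple R.
Hypothesis q0 : 0 < enorm q.

Let Q (x : n.-tuple R) := \sum_(i < n) tnth q i ^+ 2 * tnth x i ^+ 2.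

Let Q_ge0 x : 0 <= Q x.
Proof. by apply: sumr_ge0 => i _; rewrite mulr_ge0 ?sqr_ge0. Qed.

Lemma integrable_weighted_norm : (surface_measure R n).-integrable (sphere R n)
  (EFin \o (fun x => Num.sqrt (Q x))).
Proof.
apply: (@integrable_surface R n _ (enorm q)) => // [|x Sx].
  rewrite (_ : (fun x => _) = fun x => Q x `^ 2^-1).
    apply: (@measurableT_comp _ _ _ _ _ _ (@powR R ^~ 2^-1)) => //.
    apply: measurable_sum => i; apply: measurable_funM => //.
    by apply: (@measurable_tnth_comp _ _ i (fun t => t ^+ 2)); exact: measurable_funX.
  by apply/funext => x; rewrite powR12_sqrt.
rewrite ger0_norm ?sqrtr_ge0// ler_sqrt; last first.
  by apply: sumr_ge0 => i _; exact: sqr_ge0.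
apply: ler_sum => i _; rewrite ler_piMr ?sqr_ge0//.
by rewrite -[leLHS]ger0_norm ?sqr_ge0// normrX exprn_ile1// sphere_tnth_le1.
Qed.

(* Cauchy-Schwarz for the weights [q_i^2 / |q|^2], which sum to 1. *)
Lemma weighted_abs_le (x : n.-tuple R) :
  \sum_i tnth q i ^+ 2 / enorm q * `|tnth x i| <= Num.sqrt (Q x).
Proof.
set N := enorm q; pose t := (\sum_i tnth q i ^+ 2 * `|tnth x i|) / N ^+ 2.
have N2 : \sum_i tnth q i ^+ 2 = N ^+ 2 by rewrite enorm_sqr.
have tE : \sum_i tnth q i ^+ 2 * `|tnth x i| = N ^+ 2 * t.
  by rewrite /t mulrC divfK// expf_neq0// gt_eqF.
have -> : \sum_i tnth q i ^+ 2 / N * `|tnth x i| = N * t.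
  rewrite (eq_bigr (fun i => N^-1 * (tnth q i ^+ 2 * `|tnth x i|))); last first.
    by move=> i _; ring.
  by rewrite -mulr_sumr tE; field; rewrite gt_eqF.
have t0 : 0 <= t.
  by rewrite divr_ge0 ?sqr_ge0// sumr_ge0// => i _; rewrite mulr_ge0 ?sqr_ge0.
have Nt0 : 0 <= N * t by rewrite mulr_ge0// ltW.
rewrite -(ger0_norm Nt0) -sqrtr_sqr ler_sqrt// -subr_ge0.
(* The variance identity: [t] is the mean of the |x_i| for the weights q_i^2 / N^2, and the
   right-hand side is N^2 times their variance. *)
have -> : Q x - (N * t) ^+ 2 = \sum_i tnth q i ^+ 2 * (`|tnth x i| - t) ^+ 2.
  rewrite (eq_bigr (fun i => tnth q i ^+ 2 * tnth x i ^+ 2 -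
    2 * t * (tnth q i ^+ 2 * `|tnth x i|) + t ^+ 2 * tnth q i ^+ 2)); last first.
    move=> i _; rewrite -[tnth x i ^+ 2]ger0_norm ?sqr_ge0// normrX; ring.
  rewrite big_split/= sumrB -!mulr_sumr tE N2 -/(Q x); ring.
by apply: sumr_ge0 => i _; rewrite mulr_ge0 ?sqr_ge0.
Qed.

(** The pointwise bound is averaged over the sphere. All |x_i| have the same mean, and the
    coefficients q_i^2 / |q| sum to |q|. *)
Lemma mean_norm_ge : Gamma (n%:R / 2) /
    (Num.sqrt pi * Gamma ((n%:R + 1) / 2)) <= mean_norm q / enorm q.
Proof.
have [Iw wE] := @sphere_mean_lin R n (fun i => tnth q i ^+ 2 / enorm q)
  (fun i x => `|tnth x i|) (fun i => integrable_abs_tnth R i n2).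
rewrite ler_pdivlMr//.
have /(le_trans _) := le_sphere_mean n2 Iw integrable_weighted_norm
  (fun x _ => weighted_abs_le x).
apply; rewrite wE; under eq_bigr do rewrite sphere_mean_abs_tnth//.
by rewrite -!mulr_suml -enorm_sqr expr2 mulfK ?gt_eqF// mulrC.
Qed.

(* AM-GM against the constant [k = |q| / sqrt n]; the constant term is written
   as [k / 2 * \sum_i x_i^2], since the sum is 1 on the sphere. *)
Lemma mean_norm_le : mean_norm q / enorm q <= 1 / Num.sqrt n%:R.
Proof.
have n0 : 0 < n%:R :> R by rewrite ltr0n ltnW.
have sn0 : 0 < Num.sqrt n%:R :> R by rewrite sqrtr_gt0.
pose k := enorm q / Num.sqrt n%:R.
have k0 : 0 < k by rewrite divr_gt0.
have [Iw wE] := @sphere_mean_lin R n (fun i => tnth q i ^+ 2 / (2 * k) + k / 2)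
  (fun i x => tnth x i ^+ 2) (fun i => integrable_sqr_tnth R i n2).
rewrite ler_pdivrMr// mulrC mulrA mulr1 -/k.
(* Each x_i^2 has mean 1/n, so the majorant has mean |q|^2 / (2kn) + k/2, which is k because |q|^2 =
   n k^2. *)
have -> : k = \sum_i (tnth q i ^+ 2 / (2 * k) + k / 2) *
    sphere_mean (fun x : n.-tuple R => tnth x i ^+ 2).
  under eq_bigr do rewrite sphere_mean_sqr_tnth//.
  rewrite -mulr_suml big_split/= -mulr_suml -enorm_sqr sumr_const card_ord.
  have -> : enorm q ^+ 2 = k ^+ 2 * n%:R.
    by rewrite /k expr_div_n (sqr_sqrtr (ltW n0)) divfK// gt_eqF.
  by rewrite -mulr_natl; field; rewrite !gt_eqF.
rewrite -wE; apply: le_sphere_mean => //; first exact: integrable_weighted_norm.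
move=> x Sx.
have -> : \sum_i (tnth q i ^+ 2 / (2 * k) + k / 2) * tnth x i ^+ 2 =
    Q x / (2 * k) + k / 2.
  under eq_bigr do rewrite mulrDl mulrAC.
  by rewrite big_split/= -mulr_suml -mulr_sumr sphere_sum_sqr// mulr1.
have := sqr_ge0 (Num.sqrt (Q x) - k).
rewrite -{2}(sqr_sqrtr (Q_ge0 x)); set s := Num.sqrt (Q x) => sk.
(* With Q(x) = s^2, the gap between the majorant and s is a complete square divided by 2k. *)
rewrite -subr_ge0 (_ : _ - s = (s - k) ^+ 2 / (2 * k)); last first.
  by field; rewrite !gt_eqF.
by rewrite divr_ge0// mulr_ge0// ltW.
Qed.

End mean_norm_bounds.

(** * Nonzero vectors, and attainment of both bounds *)

Lemma enorm_gt0 (R : realType) (n : nat) (q : n.-tuple R) :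
  q <> [tuple 0 | _ < n] -> 0 < enorm q.
Proof.
move=> q0; rewrite lt_neqAle sqrtr_ge0 andbT; apply/eqP => qE; apply: q0.
by apply: eq_from_tnth => i; rewrite tnth_mktuple; exact: enorm_eq0_tnth.
Qed.

Theorem corollary15 (R : realType) (n : nat) (hn : (2 <= n)%N) :
  let i1 : 'I_n := Ordinal (ltnW hn) in
  let m : R := Gamma (n%:R / 2) / (Num.sqrt pi * Gamma ((n%:R + 1) / 2)) in
  let M : R := 1 / Num.sqrt n%:R in
  let zero : n.-tuple R := [tuple 0 | _ < n] in
  [/\ sphere_mean (fun x : n.-tuple R => `|tnth x i1|) = m,
      forall q : n.-tuple R, q <> zero ->
        m <= mean_norm q / enorm q <= M,
      exists q : n.-tuple R, q <> zero /\ mean_norm q / enorm q = m &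
      exists q : n.-tuple R, q <> zero /\ mean_norm q / enorm q = M].
Proof.
move=> i1 m M zero; split.
- exact: sphere_mean_abs_tnth.
- by move=> q /enorm_gt0 q0; rewrite mean_norm_ge// mean_norm_le.
- have sE (y : 'I_n -> R) : \sum_i (i == i1)%:R ^+ 2 * y i = y i1.
    rewrite (bigD1 i1)//= ?eqxx expr1n mul1r big1 ?addr0// => i /negPf ->.
    by rewrite expr0n mul0r.
  (* For the first unit vector the integrand reduces to |x_1|, whose mean is [m]. *)
  exists [tuple (i == i1)%:R | i < n]; split.
    move=> /(congr1 (fun q => tnth q i1)); rewrite !tnth_mktuple eqxx.
    by apply/eqP; exact: oner_neq0.
  have -> : enorm [tuple (i == i1)%:R | i < n] = 1 :> R.
    rewrite /enorm; under eq_bigr do rewrite tnth_mktuple -[_ ^+ 2]mulr1.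
    by rewrite sE sqrtr1.
  rewrite /m divr1 -(sphere_mean_abs_tnth R i1 hn).
  apply: eq_sphere_mean => x _; under eq_bigr do rewrite tnth_mktuple.
  by rewrite sE sqrtr_sqr.
(* For the all-ones vector the integrand is |x| = 1 on the sphere, so the mean is 1 while the
   Euclidean norm is sqrt n. *)
- exists [tuple 1 | i < n]; split.
    move=> /(congr1 (fun q => tnth q i1)); rewrite !tnth_mktuple.
    by apply/eqP; exact: oner_neq0.
  have -> : enorm [tuple 1 | _ < n] = Num.sqrt n%:R :> R.
    rewrite /enorm; under eq_bigr do rewrite tnth_mktuple expr1n.
    by rewrite sumr_const card_ord.
  congr (_ / _); apply: etrans (sphere_mean_cst1 R hn).
  apply: eq_sphere_mean => x Sx; under eq_bigr do rewrite tnth_mktuple expr1n mul1r.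
  by rewrite sphere_sum_sqr// sqrtr1.
Qed.
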